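(* Suppose that (i) for each $i=1,\dots,n$ the $i$-th component of $F$ has the form $F_i(x,\xi)=c^i(x)^\top\xi+c^i_0(x)$, and (ii) $\Xi=\{\xi\in\mathbb{R}^m\mid g_i(\xi)\le 0,\ i=1,\dots,p\}$ with $g_i(\xi)=\xi^\top\tilde A_i\xi+2\tilde b_i^\top\xi+\tilde c_i$, where $\tilde A_i\in\mathbb{S}^m$, $\tilde b_i\in\mathbb{R}^m$, $\tilde c_i\in\mathbb{R}$. Then (SIP) is conservatively approximated by (NSDP); that is, the optimal value of (NSDP) is not less than the optimal value of (SIP).
   Context: Notation: $\mathbb{S}^m$ is the set of real symmetric $m\times m$ matrices; $\mathbb{S}^m_+$ (resp. $\mathbb{S}^m_{++}$) the positive semidefinite (resp. definite) ones; $\succeq O$ means positive semidefinite; $\mathbb{R}^n_+$ is the nonnegative orthant; $\langle X,Y\rangle=\mathrm{tr}(XY)$ on $\mathbb{S}^m$ and the Euclidean inner product on vectors. Data: $\alpha>0$; $\gamma_1\ge 0$, $\gamma_2\ge 1$; $\Xi\subseteq\mathbb{R}^m$ closed and convex; $\mu_0\in\Xi$; $\Sigma_0\in\mathbb{S}^m_{++}$; $S=\{x\in\mathbb{R}^n\mid Ax=b,\ x\ge 0\}$ with $A=(a^{ji})\in\mathbb{R}^{l\times n}$ ($a^{ji}$ is the entry in row $j$, column $i$), $b\in\mathbb{R}^l$; $F:\mathbb{R}^n\times\Xi\to\mathbb{R}^n$. In the form $F_i(x,\xi)=c^i(x)^\top\xi+c^i_0(x)$, $c^i:\mathbb{R}^n\to\mathbb{R}^m$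 and $c^i_0:\mathbb{R}^n\to\mathbb{R}$. Regularized gap function: $f_\alpha(x,\xi)=\max_{y\in S}\{\langle F(x,\xi),x-y\rangle-\frac{1}{2\alpha}\|y-x\|^2\}$. (SIP): minimize $y_0+z_0+\mu_0^\top y+\langle\gamma_2\Sigma_0+\mu_0\mu_0^\top,Y\rangle$ over $(x,y_0,y,Y,z_0)\in\mathbb{R}^n\times\mathbb{R}\times\mathbb{R}^m\times\mathbb{S}^m\times\mathbb{R}$ subject to $z_0\ge\sqrt{\gamma_1}\,\|\Sigma_0^{1/2}(y+2Y\mu_0)\|$; $\xi^\top Y\xi+\xi^\top y+y_0\ge f_\alpha(x,\xi)$ for all $\xi\in\Xi$; $x\in S$; $Y\in\mathbb{S}^m_+$. Let $\mathcal{W}=\mathbb{R}^n\times\mathbb{R}^l\times\mathbb{R}^n\times\mathbb{R}\times\mathbb{R}^m\times\mathbb{S}^m$ and $w=(x,\lambda,\mu,y_0,y,Y)\in\mathcal{W}$. Put $p^i_0(x,\lambda,\mu)=c^i_0(x)+\sum_{j=1}^l a^{ji}\lambda_j-\mu_i$, $$G(x,\lambda,\mu)=\begin{bmatrix}\langle b-Ax,\lambda\rangle+\langle\mu,x\rangle&0^\top\\0&O_{m\times m}\end{bmatrix},\quad H^i(x,\lambda,\mu)=\begin{bmatrix}p^i_0(x,\lambda,\mu)^2&p^i_0(x,\lambda,\mu)c^i(x)^\top\\ p^i_0(x,\lambda,\mu)c^i(x)&c^i(x)c^i(x)^\top\end{bmatrix},$$ $$\mathcal{D}_\alpha(w)=\begin{bmatrix}y_0&\frac12y^\top\\\frac12y&Y\end{bmatrix}-\Big\{G(x,\lambda,\mu)+\frac{\alpha}{2}\sum_{i=1}^nH^i(x,\lambda,\mu)\Big\}\in\mathbb{S}^{m+1},\qquad\tilde{\mathcal{A}}_i=\begin{bmatrix}\tilde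 c_i&\tilde b_i^\top\\\tilde b_i&\tilde A_i\end{bmatrix}.$$ (NSDP): minimize $z_0+y_0+\mu_0^\top y+\langle\gamma_2\Sigma_0+\mu_0\mu_0^\top,Y\rangle$ over $(w,z_0,s)\in\mathcal{W}\times\mathbb{R}\times\mathbb{R}^p$ subject to $z_0\ge\sqrt{\gamma_1}\,\|\Sigma_0^{1/2}(y+2Y\mu_0)\|$; $\mathcal{D}_\alpha(w)+\sum_{i=1}^ps_i\tilde{\mathcal{A}}_i\succeq O$; $x\in S$; $\mu\in\mathbb{R}^n_+$; $Y\in\mathbb{S}^m_+$; $s\in\mathbb{R}^p_+$. *)

(* Defs.v *)
From HB Require Import structures.
From mathcomp Require Import all_boot all_order all_algebra.
From mathcomp Require Import all_classical all_reals all_analysis.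
From mathcomp Require Import complex.

Set Implicit Arguments.
Unset Strict Implicit.
Unset Printing Implicit Defensive.

Import Order.TTheory GRing.Theory Num.Theory.
Import numFieldNormedType.Exports.

Local Open Scope classical_set_scope.
Local Open Scope ring_scope.

Definition dotv (R : realType) (k : nat) (u v : 'cV[R]_k) : R :=
  \sum_(i < k) u i 0 * v i 0.

(* The library norm on matrices is the sup norm, hence this definition. *)
Definition enorm (R : realType) (k : nat) (u : 'cV[R]_k) : R :=
  Num.sqrt (dotv u u).

Definition mxdot (R : realType) (k : nat) (X Y : 'M[R]_k) : R := \tr (X *m Y).

Definition nonneg_vec (R : realType) (k : nat) (u : 'cV[R]_k) : Prop :=
  forall i, 0 <= u i 0.

Definition psd (R : realType) (k : nat) (X : 'M[R]_k) : Prop :=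
  X \is symmetricmx /\ forall v : 'cV[R]_k, 0 <= dotv v (X *m v).

Definition posdef (R : realType) (k : nat) (X : 'M[R]_k) : Prop :=
  X \is symmetricmx /\ forall v : 'cV[R]_k, v != 0 -> 0 < dotv v (X *m v).

(* X^{1/2}: the unique positive semidefinite square root of X; it exists for
   every positive semidefinite X by sqrtmxP. *)
Definition sqrtmx (R : realType) (k : nat) (X : 'M[R]_k) : 'M[R]_k :=
  xget 0 [set Z : 'M[R]_k | psd Z /\ Z *m Z = X].

Lemma interpolation (K : fieldType) (g : K -> K) (s : seq K) :
  exists q : {poly K}, forall x, x \in s -> q.[x] = g x.
Proof.
elim: s => [|a s [q IH]]; first by exists 0.
have [sa|sa] := boolP (a \in s).
  by exists q => x; rewrite inE => /predU1P[->|]; exact: IH.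
pose w := \prod_(y <- s) ('X - y%:P).
have wE x : root w x = (x \in s) by rewrite root_prod_XsubC.
exists (q + ((g a - q.[a]) / w.[a]) *: w) => x; rewrite inE !hornerE.
case/predU1P => [->|sx]; first by rewrite divfK ?subrKC// -rootE wE.
have /rootP -> : root w x by rewrite wE.
by rewrite mulr0 addr0 IH.
Qed.

Lemma psd_eigen_ge0 (R : realType) (k : nat) (A : 'M[R]_k) (a : R) :
  psd A -> eigenvalue A a -> 0 <= a.
Proof.
move=> [/is_hermitianmxP symA posA] /eigenvalueP[v vA v0].
have E : dotv v^T (A *m v^T) = a * dotv v^T v^T.
  have -> : A *m v^T = a *: v^T.
    by rewrite -linearZ /= -vA trmx_mul [in LHS]symA expr0 scale1r map_mx_id.
  by rewrite /dotv mulr_sumr; apply: eq_bigr => i _; rewrite !mxE mulrCA.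
have vv0 : 0 < dotv v^T v^T.
  rewrite lt_def sumr_ge0 ?andbT; last first.
    by move=> i _; rewrite -expr2 sqr_ge0.
  apply: contraNneq v0 => /eqP; rewrite psumr_eq0; last first.
    by move=> i _; rewrite -expr2 sqr_ge0.
  move=> /allP h; apply/eqP/rowP => i; rewrite mxE.
  have := h i (mem_index_enum _); rewrite -expr2 sqrf_eq0 mxE.
  by move=> /eqP.
by rewrite -(pmulr_lge0 _ vv0) -E.
Qed.

(* The square root is obtained as the square of a polynomial in A that
   interpolates the fourth root on the (real, nonnegative) spectrum of A. *)
Lemma psd_fourth_root (R : realType) (k : nat) (A : 'M[R]_k.+1) : psd A ->
  exists q : {poly R}, horner_mx A q ^+ 4 = A.
Proof.
move=> psdA; have [/is_hermitianmxP symA _] := psdA.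
rewrite expr0 scale1r map_mx_id // in symA.
pose C : numClosedFieldType := R[i].
pose f : {rmorphism R -> C} := real_complex R.
pose B := map_mx f A; pose P := spectralmx B; pose d := spectral_diag B.
have hB : B \is hermsymmx.
  apply: realsym_hermsym.
    apply/is_hermitianmxP; rewrite expr0 scale1r map_mx_id //.
    by rewrite /B [in LHS]symA map_trmx.
  by apply/mxOverP => i j; rewrite mxE complex_real.
have /hermitian_normalmx/orthomx_spectralP EB := hB; rewrite -/P -/d in EB.
have uP : P \in unitmx := spectral_unit B.
pose e j := complex.Re (d 0 j).
have dE j : d 0 j = f (e j).
  have dR : d 0 j \is Num.real := mxOverP (hermitian_spectral_diag_real hB) 0 j.
  exact/esym/(RRe_real dR).
have e_ge0 j : 0 <= e j.
  apply: (psd_eigen_ge0 psdA).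
  rewrite eigenvalue_root_char -(fmorph_root f) map_char_poly.
  rewrite -eigenvalue_root_char; apply/eigenvalueP; exists (row j P).
    rewrite -row_mul -/B EB !mulmxA mulmxV // mul1mx -dE.
    by apply/rowP => i; rewrite mul_diag_mx !mxE.
  apply: contraTneq uP => rj0; rewrite -row_free_unit.
  apply/negP => /row_freeP [Q PQ].
  have := congr1 (fun M : 'M[C]_k.+1 => M j j) PQ; rewrite !mxE eqxx big1 => [/eqP|i _].
    by rewrite eq_sym oner_eq0.
  by move/rowP/(_ i): rj0; rewrite !mxE => ->; rewrite mul0r.
have [q qE] := interpolation (fun x => Num.sqrt (Num.sqrt x)) [seq e j | j : 'I_k.+1].
exists q; apply: (map_mx_inj (f := f)).
rewrite -rmorphXn /= map_horner_mx -/B [in LHS]EB horner_mx_uconjC //.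
rewrite [RHS]EB horner_mx_diag; congr (_ *m diag_mx _ *m _).
apply/rowP => j; rewrite mxE dE rmorphXn /= hornerE horner_map /= qE ?map_f ?mem_enum //.
by rewrite -rmorphXn /= (exprM _ 2 2) !sqr_sqrtr ?sqrtr_ge0.
Qed.

Lemma sqrtmxP (R : realType) (k : nat) (A : 'M[R]_k) : psd A ->
  psd (sqrtmx A) /\ sqrtmx A *m sqrtmx A = A.
Proof.
move=> psdA; rewrite /sqrtmx.
suff [Z hZ] : exists Z : 'M[R]_k, psd Z /\ Z *m Z = A by exact: (xgetI (P := [set Z : 'M[R]_k | psd Z /\ Z *m Z = A]) 0 hZ).
case: k A psdA => [|k] A psdA; first by exists A; split=> //; rewrite [LHS]flatmx0 [RHS]flatmx0.
have [q qA] := psd_fourth_root psdA.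
pose T := horner_mx A q; exists (T *m T); split; last first.
  by rewrite -[RHS]qA (exprD _ 2 2).
have symT : T^T = T.
  case: psdA => /is_hermitianmxP; rewrite expr0 scale1r map_mx_id // => symA _.
  rewrite /T; elim/poly_ind: {qA T} q => [|q c IH]; first by rewrite !rmorph0 trmx0.
  rewrite rmorphD rmorphM /= horner_mx_X horner_mx_C linearD /= tr_scalar_mx.
  rewrite trmx_mul IH -symA; congr (_ + _).
  exact: (comm_mx_horner q (comm_mx_refl A)).
split; first by apply/is_hermitianmxP; rewrite expr0 scale1r map_mx_id // trmx_mul symT.
move=> v; have -> : dotv v (T *m T *m v) = dotv (T *m v) (T *m v).
  have dotvE (u w : 'cV[R]_k.+1) : dotv u w = (u^T *m w) 0 0.
    by rewrite /dotv mxE; apply: eq_bigr => i _; rewrite mxE.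
  by rewrite !dotvE trmx_mul symT !mulmxA.
by apply: sumr_ge0 => i _; rewrite -expr2 sqr_ge0.
Qed.

Definition polyhedron (R : realType) (l n : nat) (A : 'M[R]_(l, n))
    (b : 'cV[R]_l) : set 'cV[R]_n :=
  [set x | A *m x = b /\ nonneg_vec x].

(* The regularized gap function.  Its objective is continuous and strongly
   concave in y, so the supremum is a maximum as soon as the closed set S is
   nonempty; it is -oo for empty S. *)
Definition gap (R : realType) (m n : nat) (alpha : R) (S : set 'cV[R]_n)
    (F : 'cV[R]_n -> 'cV[R]_m -> 'cV[R]_n)
    (x : 'cV[R]_n) (xi : 'cV[R]_m) : \bar R :=
  ereal_sup [set (dotv (F x xi) (x - y)
                  - (2 * alpha)^-1 * enorm (y - x) ^+ 2)%:E | y in S].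

Definition objective (R : realType) (m : nat) (gamma2 : R) (mu0 : 'cV[R]_m)
    (Sigma0 : 'M[R]_m) (y0 : R) (y : 'cV[R]_m) (Y : 'M[R]_m) (z0 : R) : R :=
  y0 + z0 + dotv mu0 y + mxdot (gamma2 *: Sigma0 + mu0 *m mu0^T) Y.

Definition norm_constraint (R : realType) (m : nat) (gamma1 : R)
    (mu0 : 'cV[R]_m) (Sigma0 : 'M[R]_m) (y : 'cV[R]_m) (Y : 'M[R]_m)
    (z0 : R) : Prop :=
  Num.sqrt gamma1 * enorm (sqrtmx Sigma0 *m (y + 2 *: (Y *m mu0))) <= z0.

(* Membership of Y in the symmetric matrices is part of the feasibility
   conditions below, through psd Y. *)
Record sip_var (R : realType) (m n : nat) := SipVar {
  sip_x : 'cV[R]_n; sip_y0 : R; sip_y : 'cV[R]_m; sip_Y : 'M[R]_m; sip_z0 : R }.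

Definition sip_feasible (R : realType) (m n : nat) (alpha gamma1 : R)
    (Xi : set 'cV[R]_m) (mu0 : 'cV[R]_m) (Sigma0 : 'M[R]_m)
    (S : set 'cV[R]_n) (F : 'cV[R]_n -> 'cV[R]_m -> 'cV[R]_n) :
    set (sip_var R m n) :=
  [set v | [/\ norm_constraint gamma1 mu0 Sigma0 (sip_y v) (sip_Y v) (sip_z0 v),
    forall xi, Xi xi ->
      (gap alpha S F (sip_x v) xi <=
       (dotv xi (sip_Y v *m xi) + dotv xi (sip_y v) + sip_y0 v)%:E)%E,
    S (sip_x v) & psd (sip_Y v)]].

Definition sip_value (R : realType) (m n : nat) (alpha gamma1 gamma2 : R)
    (Xi : set 'cV[R]_m) (mu0 : 'cV[R]_m) (Sigma0 : 'M[R]_m)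
    (S : set 'cV[R]_n) (F : 'cV[R]_n -> 'cV[R]_m -> 'cV[R]_n) : \bar R :=
  ereal_inf [set (objective gamma2 mu0 Sigma0
                    (sip_y0 v) (sip_y v) (sip_Y v) (sip_z0 v))%:E
            | v in sip_feasible alpha gamma1 Xi mu0 Sigma0 S F].

Record nsdp_var (R : realType) (m n l p : nat) := NsdpVar {
  nsdp_x : 'cV[R]_n; nsdp_lambda : 'cV[R]_l; nsdp_mu : 'cV[R]_n;
  nsdp_y0 : R; nsdp_y : 'cV[R]_m; nsdp_Y : 'M[R]_m;
  nsdp_z0 : R; nsdp_s : 'cV[R]_p }.

Definition p0 (R : realType) (n l : nat) (A : 'M[R]_(l, n))
    (c0 : 'I_n -> 'cV[R]_n -> R) (i : 'I_n)
    (x : 'cV[R]_n) (lambda : 'cV[R]_l) (mu : 'cV[R]_n) : R :=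
  c0 i x + \sum_(j < l) A j i * lambda j 0 - mu i 0.

(* The (1 + m) x (1 + m) matrix with blocks a, b^T, b, Q. *)
Definition bordered (R : realType) (m : nat) (a : R) (b : 'cV[R]_m)
    (Q : 'M[R]_m) : 'M[R]_(1 + m) :=
  block_mx a%:M b^T b Q.

Definition Gmx (R : realType) (m n l : nat) (A : 'M[R]_(l, n)) (b : 'cV[R]_l)
    (x : 'cV[R]_n) (lambda : 'cV[R]_l) (mu : 'cV[R]_n) : 'M[R]_(1 + m) :=
  bordered (dotv (b - A *m x) lambda + dotv mu x) 0 0.

Definition Hmx (R : realType) (m n l : nat) (A : 'M[R]_(l, n))
    (c : 'I_n -> 'cV[R]_n -> 'cV[R]_m) (c0 : 'I_n -> 'cV[R]_n -> R)
    (i : 'I_n) (x : 'cV[R]_n) (lambda : 'cV[R]_l) (mu : 'cV[R]_n) :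
    'M[R]_(1 + m) :=
  bordered (p0 A c0 i x lambda mu ^+ 2) (p0 A c0 i x lambda mu *: c i x)
    (c i x *m (c i x)^T).

Definition Dmx (R : realType) (m n l p : nat) (alpha : R) (A : 'M[R]_(l, n))
    (b : 'cV[R]_l) (c : 'I_n -> 'cV[R]_n -> 'cV[R]_m)
    (c0 : 'I_n -> 'cV[R]_n -> R) (v : nsdp_var R m n l p) : 'M[R]_(1 + m) :=
  bordered (nsdp_y0 v) (2^-1 *: nsdp_y v) (nsdp_Y v)
  - (Gmx m A b (nsdp_x v) (nsdp_lambda v) (nsdp_mu v)
     + (alpha / 2) *: \sum_(i < n)
         Hmx A c c0 i (nsdp_x v) (nsdp_lambda v) (nsdp_mu v)).

Definition nsdp_feasible (R : realType) (m n l p : nat) (alpha gamma1 : R)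
    (mu0 : 'cV[R]_m) (Sigma0 : 'M[R]_m) (A : 'M[R]_(l, n)) (b : 'cV[R]_l)
    (c : 'I_n -> 'cV[R]_n -> 'cV[R]_m) (c0 : 'I_n -> 'cV[R]_n -> R)
    (tA : 'I_p -> 'M[R]_m) (tb : 'I_p -> 'cV[R]_m) (tc : 'I_p -> R) :
    set (nsdp_var R m n l p) :=
  [set v |
    norm_constraint gamma1 mu0 Sigma0 (nsdp_y v) (nsdp_Y v) (nsdp_z0 v) /\
    psd (Dmx alpha A b c c0 v
         + \sum_(i < p) nsdp_s v i 0 *: bordered (tc i) (tb i) (tA i)) /\
    polyhedron A b (nsdp_x v) /\
    nonneg_vec (nsdp_mu v) /\
    psd (nsdp_Y v) /\
    nonneg_vec (nsdp_s v)].

Definition nsdp_value (R : realType) (m n l p : nat) (alpha gamma1 gamma2 : R)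
    (mu0 : 'cV[R]_m) (Sigma0 : 'M[R]_m) (A : 'M[R]_(l, n)) (b : 'cV[R]_l)
    (c : 'I_n -> 'cV[R]_n -> 'cV[R]_m) (c0 : 'I_n -> 'cV[R]_n -> R)
    (tA : 'I_p -> 'M[R]_m) (tb : 'I_p -> 'cV[R]_m) (tc : 'I_p -> R) : \bar R :=
  ereal_inf [set (objective gamma2 mu0 Sigma0
                    (nsdp_y0 v) (nsdp_y v) (nsdp_Y v) (nsdp_z0 v))%:E
            | v in nsdp_feasible alpha gamma1 mu0 Sigma0 A b c c0 tA tb tc].

(* Main.v *)
Require Import Defs.
From HB Require Import structures.
From mathcomp Require Import all_boot all_order all_algebra.
From mathcomp Require Import all_classical all_reals all_analysis.
From mathcomp Require Import ring lra.

(** Weak duality, in two places, makes every feasible point of the semidefinite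
program feasible, with the same objective value, for the semi-infinite one.

Fix [xi] and put [q i := (c i x)^T xi + p0 i], the [i]-th entry of
[F(x, xi) + A^T lambda - mu]: up to sign, it is the gradient at [y = x] of the
Lagrangian of the maximization over [y] that defines the gap function.  Since [A x = A y = b] and
[<mu, y> >= 0], every candidate [y] has
[<F, x - y> <= <q, x - y> + <mu, x>], and completing the square in [x - y]
bounds the penalized objective by [<mu, x> + alpha / 2 * |q|^2], whatever [y]
is ([gap_le]).  That bound is exactly the quadratic form of
[G + alpha / 2 * sum_i H^i] at the vector [(1, xi)].

The semi-infinite constraint therefore follows once the quadratic form of
[D_alpha(w)] at [(1, xi)] is nonnegative.  The matrix inequality says that it
is at least [- sum_i s_i g_i(xi)], which is nonnegative on [Xi] because
[s >= 0 >= g(xi)]: this is the easy direction of the S-procedure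
([nsdp_majorant]). *)

Set Implicit Arguments.
Unset Strict Implicit.
Unset Printing Implicit Defensive.

Import Order.TTheory GRing.Theory Num.Theory.
Import numFieldNormedType.Exports.

Local Open Scope classical_set_scope.
Local Open Scope ring_scope.

(** * The inner product and quadratic forms *)

Lemma dotvDl (R : realType) (k : nat) (u v w : 'cV[R]_k) :
  dotv (u + v) w = dotv u w + dotv v w.
Proof. by rewrite /dotv -big_split; apply: eq_bigr => i _; rewrite mxE mulrDl. Qed.

Lemma dotvDr (R : realType) (k : nat) (u v w : 'cV[R]_k) :
  dotv u (v + w) = dotv u v + dotv u w.
Proof. by rewrite /dotv -big_split; apply: eq_bigr => i _; rewrite mxE mulrDr. Qed.

Lemma dotvZl (R : realType) (k : nat) (a : R) (u v : 'cV[R]_k) :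
  dotv (a *: u) v = a * dotv u v.
Proof. by rewrite /dotv mulr_sumr; apply: eq_bigr => i _; rewrite mxE mulrA. Qed.

Lemma dotvZr (R : realType) (k : nat) (a : R) (u v : 'cV[R]_k) :
  dotv u (a *: v) = a * dotv u v.
Proof. by rewrite /dotv mulr_sumr; apply: eq_bigr => i _; rewrite mxE mulrCA. Qed.

Lemma dotvC (R : realType) (k : nat) (u v : 'cV[R]_k) : dotv u v = dotv v u.
Proof. by apply: eq_bigr => i _; rewrite mulrC. Qed.

Lemma dotvBr (R : realType) (k : nat) (u v w : 'cV[R]_k) :
  dotv u (v - w) = dotv u v - dotv u w.
Proof. by rewrite dotvDr -scaleN1r dotvZr mulN1r. Qed.

Lemma dotvBl (R : realType) (k : nat) (u v w : 'cV[R]_k) :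
  dotv (u - v) w = dotv u w - dotv v w.
Proof. by rewrite ![dotv _ w]dotvC dotvBr. Qed.

Lemma dotv0l (R : realType) (k : nat) (u : 'cV[R]_k) : dotv 0 u = 0.
Proof. by rewrite -(scale0r 0) dotvZl mul0r. Qed.

Lemma dotvE (R : realType) (k : nat) (u v : 'cV[R]_k) :
  dotv u v = (u^T *m v) 0 0.
Proof. by rewrite mxE; apply: eq_bigr => i _; rewrite mxE. Qed.

Lemma dotv_trmxl (R : realType) (k l : nat) (A : 'M[R]_(l, k))
    (u : 'cV[R]_l) (v : 'cV[R]_k) : dotv (A^T *m u) v = dotv u (A *m v).
Proof. by rewrite !dotvE trmx_mul trmxK mulmxA. Qed.

Lemma dotv_col_mx (R : realType) (k l : nat) (u1 v1 : 'cV[R]_k)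
    (u2 v2 : 'cV[R]_l) :
  dotv (col_mx u1 u2) (col_mx v1 v2) = dotv u1 v1 + dotv u2 v2.
Proof. by rewrite !dotvE tr_col_mx mul_row_col mxE. Qed.

Lemma dotv_ge0 (R : realType) (k : nat) (u v : 'cV[R]_k) :
  nonneg_vec u -> nonneg_vec v -> 0 <= dotv u v.
Proof. by move=> u0 v0; apply: sumr_ge0 => i _; apply: mulr_ge0. Qed.

Lemma enorm_sqr (R : realType) (k : nat) (u : 'cV[R]_k) :
  enorm u ^+ 2 = dotv u u.
Proof. by rewrite sqr_sqrtr //; apply: sumr_ge0 => i _; rewrite -expr2 sqr_ge0. Qed.

(** The Fenchel inequality for the pair of conjugate functions
[|.|^2 / (2 alpha)] and [alpha / 2 * |.|^2]. *)
Lemma dotv_sub_sqr_le (R : realType) (k : nat) (alpha : R) (q d : 'cV[R]_k) :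
  0 < alpha ->
  dotv q d - (2 * alpha)^-1 * dotv d d <= alpha / 2 * dotv q q.
Proof.
move=> a0; rewrite /dotv !mulr_sumr -sumrB; apply: ler_sum => i _.
set x := q i 0; set y := d i 0.
rewrite -subr_ge0.
have -> : alpha / 2 * (x * x) - (x * y - (2 * alpha)^-1 * (y * y)) =
    (2 * alpha)^-1 * (alpha * x - y) ^+ 2 by field; rewrite gt_eqF.
by rewrite mulr_ge0 ?sqr_ge0 ?invr_ge0 ?mulr_ge0 ?ltW.
Qed.

Definition qform (R : realType) (k : nat) (v : 'cV[R]_k) (X : 'M[R]_k) : R :=
  dotv v (X *m v).

Fact qform_is_linear (R : realType) (k : nat) (v : 'cV[R]_k) :
  linear (qform v : 'M[R]_k -> R^o).
Proof.
by move=> a X Y; rewrite /qform mulmxDl -scalemxAl dotvDr dotvZr.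
Qed.

HB.instance Definition _ (R : realType) (k : nat) (v : 'cV[R]_k) :=
  GRing.isLinear.Build R 'M[R]_k R^o _ (qform v) (qform_is_linear v).

Lemma qformZ (R : realType) (k : nat) (v : 'cV[R]_k) (a : R) (X : 'M[R]_k) :
  qform v (a *: X) = a * qform v X.
Proof. exact: linearZ. Qed.

(** Homogenization: bordered matrices encode inhomogeneous quadratic functions
as quadratic forms at vectors whose leading entry is 1. *)
Lemma qform_bordered (R : realType) (m : nat) (a : R) (b : 'cV[R]_m)
    (Q : 'M[R]_m) (xi : 'cV[R]_m) :
  qform (col_mx 1%:M xi) (bordered a b Q) =
  a + 2 * dotv b xi + dotv xi (Q *m xi).
Proof.
rewrite /qform /bordered mul_block_col dotv_col_mx !mulmx1 dotvDr dotvDr.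
have dotv1 (M : 'cV[R]_1) : dotv 1%:M M = M 0 0.
  by rewrite dotvE tr_scalar_mx mul1mx.
rewrite !dotv1 -dotvE mxE eqxx mulr1n (dotvC xi b); ring.
Qed.

(** * The bound on the gap function *)

(** The right-hand side does not involve the maximization variable: it is the
value of the Lagrangian dual at the multipliers [lambda] and [mu]. *)
Lemma gap_le (R : realType) (m n l : nat) (alpha : R) (A : 'M[R]_(l, n))
    (b : 'cV[R]_l) (F : 'cV[R]_n -> 'cV[R]_m -> 'cV[R]_n)
    (x : 'cV[R]_n) (xi : 'cV[R]_m) (lambda : 'cV[R]_l) (mu : 'cV[R]_n) :
  0 < alpha -> A *m x = b -> nonneg_vec mu ->
  (gap alpha (polyhedron A b) F x xi <=
   (dotv mu x
    + alpha / 2 * enorm (F x xi + A^T *m lambda - mu) ^+ 2)%:E)%E.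
Proof.
rewrite enorm_sqr; set q := _ - mu => a0 Ax mu0.
apply: ge_ereal_sup => _ [y [Ay y0] <-].
rewrite lee_fin.
have := dotv_sub_sqr_le q (x - y) a0.
have -> : dotv q (x - y) = dotv (F x xi) (x - y) - dotv mu (x - y).
  rewrite dotvBl dotvDl dotv_trmxl mulmxBr Ax Ay subrr.
  by rewrite [dotv lambda 0]dotvC dotv0l addr0.
have -> : enorm (y - x) ^+ 2 = dotv (x - y) (x - y).
  by rewrite enorm_sqr; apply: eq_bigr => i _; rewrite !mxE; ring.
have := dotv_ge0 mu0 y0; rewrite [dotv mu (x - y)]dotvBr; lra.
Qed.

(** * The quadratic majorant supplied by the matrix inequality *)

Lemma qform_Hmx (R : realType) (m n l : nat) (A : 'M[R]_(l, n))
    (c : 'I_n -> 'cV[R]_n -> 'cV[R]_m) (c0 : 'I_n -> 'cV[R]_n -> R)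
    (i : 'I_n) (x : 'cV[R]_n) (lambda : 'cV[R]_l) (mu : 'cV[R]_n)
    (xi : 'cV[R]_m) :
  qform (col_mx 1%:M xi) (Hmx A c c0 i x lambda mu) =
  (dotv (c i x) xi + p0 A c0 i x lambda mu) ^+ 2.
Proof.
rewrite qform_bordered dotvZl.
have -> : dotv xi (c i x *m (c i x)^T *m xi) = dotv (c i x) xi ^+ 2.
  rewrite -mulmxA dotvE mulmxA mxE big_ord1 -!dotvE (dotvC xi).
  by rewrite expr2.
ring.
Qed.

(** For fixed [xi], the multipliers [s] turn the constraints [g_i(xi) <= 0] into
a nonpositive term, so that the matrix inequality forces nonnegativity of the
quadratic form of [D_alpha] at [(1, xi)]; the conclusion is that nonnegativity
written out. *)
Lemma nsdp_majorant (R : realType) (m n l p : nat) (alpha : R)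
    (A : 'M[R]_(l, n)) (b : 'cV[R]_l)
    (c : 'I_n -> 'cV[R]_n -> 'cV[R]_m) (c0 : 'I_n -> 'cV[R]_n -> R)
    (tA : 'I_p -> 'M[R]_m) (tb : 'I_p -> 'cV[R]_m) (tc : 'I_p -> R)
    (v : nsdp_var R m n l p) (xi : 'cV[R]_m) :
  psd (Dmx alpha A b c c0 v
       + \sum_(i < p) nsdp_s v i 0 *: bordered (tc i) (tb i) (tA i)) ->
  A *m nsdp_x v = b -> nonneg_vec (nsdp_s v) ->
  (forall i, dotv xi (tA i *m xi) + 2 * dotv (tb i) xi + tc i <= 0) ->
  dotv (nsdp_mu v) (nsdp_x v) + alpha / 2 * \sum_(i < n)
    (dotv (c i (nsdp_x v)) xi
     + p0 A c0 i (nsdp_x v) (nsdp_lambda v) (nsdp_mu v)) ^+ 2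
  <= dotv xi (nsdp_Y v *m xi) + dotv xi (nsdp_y v) + nsdp_y0 v.
Proof.
move=> [_ /(_ (col_mx 1%:M xi)) psdD] Ax s0 gxi.
have sg0 : qform (col_mx 1%:M xi)
    (\sum_(i < p) nsdp_s v i 0 *: bordered (tc i) (tb i) (tA i)) <= 0.
  rewrite linear_sum /=; apply: sumr_le0 => i _.
  rewrite qformZ; apply: mulr_ge0_le0 => //=.
  by rewrite qform_bordered; have := gxi i; lra.
have : 0 <= qform (col_mx 1%:M xi) (Dmx alpha A b c c0 v).
  by move: psdD; rewrite -/(qform _ _) linearD /=; lra.
rewrite /Dmx linearB linearD /= qformZ linear_sum /= !qform_bordered.
under eq_bigr do rewrite qform_Hmx.
rewrite Ax subrr mul0mx !dotv0l [dotv xi 0]dotvC dotv0l dotvZl.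
rewrite (dotvC xi (nsdp_y v)) /=; lra.
Qed.

Theorem theorem2p9 (R : realType) (m n l p : nat) (alpha gamma1 gamma2 : R)
    (Xi : set 'cV[R]_m) (mu0 : 'cV[R]_m) (Sigma0 : 'M[R]_m)
    (A : 'M[R]_(l, n)) (b : 'cV[R]_l)
    (F : 'cV[R]_n -> 'cV[R]_m -> 'cV[R]_n)
    (c : 'I_n -> 'cV[R]_n -> 'cV[R]_m) (c0 : 'I_n -> 'cV[R]_n -> R)
    (tA : 'I_p -> 'M[R]_m) (tb : 'I_p -> 'cV[R]_m) (tc : 'I_p -> R)
    (alpha_gt0 : 0 < alpha) (gamma1_ge0 : 0 <= gamma1) (gamma2_ge1 : 1 <= gamma2)
    (Xi_closed : closed Xi) (Xi_convex : convex_set Xi) (Xi_mu0 : Xi mu0)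
    (Sigma0_posdef : posdef Sigma0)
    (F_affine : forall (i : 'I_n) (x : 'cV[R]_n) (xi : 'cV[R]_m), Xi xi ->
       F x xi i 0 = dotv (c i x) xi + c0 i x)
    (tA_sym : forall i : 'I_p, tA i \is symmetricmx)
    (Xi_def : Xi = [set xi : 'cV[R]_m | forall i : 'I_p,
       dotv xi (tA i *m xi) + 2 * dotv (tb i) xi + tc i <= 0]) :
  (sip_value alpha gamma1 gamma2 Xi mu0 Sigma0 (polyhedron A b) F <=
   nsdp_value alpha gamma1 gamma2 mu0 Sigma0 A b c c0 tA tb tc)%E.
Proof.
apply: le_ereal_inf => _ [v [vnorm [vpsd [[Ax x0] [mu_ge0 [Ypsd s0]]]]] <-].
exists (SipVar (nsdp_x v) (nsdp_y0 v) (nsdp_y v) (nsdp_Y v) (nsdp_z0 v)) => //.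
split=> //= xi Xi_xi.
apply: (le_trans (gap_le F xi (nsdp_lambda v) alpha_gt0 Ax mu_ge0)).
have gxi := Xi_xi; rewrite Xi_def /= in gxi.
rewrite lee_fin; apply: le_trans (nsdp_majorant vpsd Ax s0 gxi).
rewrite enorm_sqr lerD2l le_eqVlt; apply/orP; left; apply/eqP; congr (_ * _).
apply: eq_bigr => i _; rewrite -expr2; congr (_ ^+ 2).
rewrite !mxE F_affine // /p0 !addrA; congr (_ + _ - _).
by apply: eq_bigr => j _; rewrite mxE.
Qed.
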